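(* Let $\ell\ge5$ and $p=3$ with $9\mid N$ (with $f$, $N$, $\bar\rho$ as in the context). If the inertial type at $3$ is $\tau_{\mathrm{sc},3}(-3,4,6)_j$ with $j\in\{0,1,2\}$, then $$H^0(G_3,\bar\varepsilon_\ell\otimes\mathrm{ad}^0\bar\rho)=0$$ for every $j\in\{0,1,2\}$, in each of the cases $3\not\equiv\pm1\pmod\ell$, $3\equiv-1\pmod\ell$ and $3\equiv1\pmod\ell$; in particular the three types give identical results, with no $j$-dependent correction.
   Context: $f$ is a normalized weight $2$ newform of level $N$ corresponding to an elliptic curve $E_f/\mathbb{Q}$ of conductor $N$, $\kappa$ is a finite field of characteristic $\ell$ with $\ell\nmid N$, $S$ is a finite set of places of $\mathbb{Q}$ containing $\infty$ and the primes dividing $N\ell$, and $\bar\rho:G_{\mathbb{Q},S}\to\mathrm{GL}_2(\kappa)$ is the residual representation attached to $f$. Throughout: $\bar\rho$ is odd, continuous and absolutely irreducible, $f$ is ordinary at $\ell$ ($a_\ell(f)\not\equiv0\bmod\ell$), and the deformation problem for $\bar\rho$ is minimally ramified at all primes dividing $N$; at a prime $p$ of supercuspidal type this means that deformations restricted to $G_p$ are of the form $\mathrm{Ind}_{G_K}^{G_p}\chi$ with $\chi$ a lift of $\bar\chi$ (below) of the same conductor exponent. $G_3$ is a decomposition group at $3$; $\bar\varepsilon_\ell$ is the mod $\ell$ cyclotomic character; $\mathrm{ad}^0\bar\rho$ is the space of trace-zero $2\times2$ matrices over $\kappa$ with conjugation action via $\bar\rho$. $E_f$ has additive, potentially good reduction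 at $3$. The type $\tau_{\mathrm{sc},3}(-3,4,6)_j$ is the inertial type of $\mathrm{Ind}_{G_K}^{G_3}\chi_j$, where $K=\mathbb{Q}_3(\sqrt{-3})$ (totally ramified over $\mathbb{Q}_3$), and $\chi_j$ has conductor exponent $4$ and order $6$ on $I_K$ and, viewed on $\mathcal{O}_K^\times$ by class field theory, satisfies $\chi_j(-\xi_6)=\zeta_3^{\,j}$ and $\chi_j(\xi_6-3)=-\zeta_3^{\,j-1}$, with $\xi_6\in K$ a primitive sixth root of unity and $\zeta_3$ a primitive cube root of unity. Residually $\bar\rho|_{G_3}\cong\mathrm{Ind}_{G_K}^{G_3}\bar\chi_j$ with $\bar\chi_j$ the reduction of $\chi_j$, $\bar\chi_j\ne\bar\chi_j^s$, where $\bar\chi_j^s$ is the conjugate of $\bar\chi_j$ under $\mathrm{Gal}(K/\mathbb{Q}_3)$. *)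

(* Defs.v *)
From HB Require Import structures.
From mathcomp Require Import all_boot all_order all_fingroup all_algebra all_field.
From mathcomp Require Import complex.
From mathcomp Require Import all_classical all_reals all_analysis.

Set Implicit Arguments.
Unset Strict Implicit.
Unset Printing Implicit Defensive.

Import Order.TTheory GRing.Theory Num.Theory.
Import numFieldNormedType.Exports.

Local Open Scope classical_set_scope.
Local Open Scope ring_scope.


(* An automorphism is stored together with its inverse, so that the inverse of
   the group structure is computable. *)
Definition is_field_aut (F : fieldType) (p : (F -> F) * (F -> F)) : Prop :=
  [/\ cancel p.1 p.2, cancel p.2 p.1, p.1 1 = 1,
      {morph p.1 : x y / x + y} & {morph p.1 : x y / x * y}].

Record fieldAut (F : fieldType) := FieldAut {
  autp : (F -> F) * (F -> F);
  autpP : `[< is_field_aut autp >] }.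

HB.instance Definition _ (F : fieldType) := [isSub for @autp F].
HB.instance Definition _ (F : fieldType) := [Choice of fieldAut F by <:].

Definition aut_fun (F : fieldType) (s : fieldAut F) : F -> F := (autp s).1.
Coercion aut_fun : fieldAut >-> Funclass.

Section FieldAutGroup.
Variable F : fieldType.
Implicit Types s t : fieldAut F.

Lemma aut1_subproof : `[< is_field_aut ((id, id) : (F -> F) * (F -> F)) >].
Proof. by apply/asboolP. Qed.

Lemma autV_subproof s : `[< is_field_aut ((autp s).2, (autp s).1) >].
Proof.
have /asboolP [fK gK f1 fD fM] := autpP s; apply/asboolP; split=> //=.
- by rewrite -[X in (autp s).2 X = _]f1 fK.
- by move=> x y; apply: (can_inj fK); rewrite fD !gK.
- by move=> x y; apply: (can_inj fK); rewrite fM !gK.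
Qed.

Lemma autM_subproof s t :
  `[< is_field_aut ((autp s).1 \o (autp t).1, (autp t).2 \o (autp s).2) >].
Proof.
have /asboolP [fK gK f1 fD fM] := autpP s.
have /asboolP [fK' gK' f1' fD' fM'] := autpP t.
apply/asboolP; split=> /=.
- exact: can_comp.
- exact: can_comp.
- by rewrite f1' f1.
- by move=> x y; rewrite /= fD' fD.
- by move=> x y; rewrite /= fM' fM.
Qed.

Definition aut1 : fieldAut F := FieldAut aut1_subproof.
Definition autV s : fieldAut F := FieldAut (autV_subproof s).
Definition autM s t : fieldAut F := FieldAut (autM_subproof s t).

Lemma autMA : associative autM.
Proof. by move=> s t u; apply: val_inj. Qed.
Lemma aut1M : left_id aut1 autM.
Proof. by move=> s; apply: val_inj => /=; case: (autp s). Qed.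
Lemma autM1 : right_id aut1 autM.
Proof. by move=> s; apply: val_inj => /=; case: (autp s). Qed.
Lemma autVM : left_inverse aut1 autV autM.
Proof.
move=> s; apply: val_inj => /=; have /asboolP [fK gK _ _ _] := autpP s.
by congr pair; apply/funext => x /=; rewrite fK.
Qed.
Lemma autMV : right_inverse aut1 autV autM.
Proof.
move=> s; apply: val_inj => /=; have /asboolP [fK gK _ _ _] := autpP s.
by congr pair; apply/funext => x /=; rewrite gK.
Qed.

HB.instance Definition _ :=
  isGroup.Build (fieldAut F) autMA aut1M autM1 autVM autMV.

End FieldAutGroup.

Definition fixing (F : fieldType) (A : set F) : set (fieldAut F) :=
  [set s | forall x, A x -> s x = x].

Definition fixfield (F : fieldType) (H : set (fieldAut F)) : set F :=
  [set x | forall s, H s -> s x = x].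

(* Additive valuations with rational values.  The value at 0 is irrelevant:
   [vge v r x] and [vgt v r x] give 0 the valuation +oo. *)
Definition vge (F : fieldType) (v : F -> rat) (r : rat) (x : F) : bool :=
  (x == 0) || (r <= v x).
Definition vgt (F : fieldType) (v : F -> rat) (r : rat) (x : F) : bool :=
  (x == 0) || (r < v x).

Definition padic_valuation (F : fieldType) (p : nat) (v : F -> rat) : Prop :=
  [/\ p%:R != 0 :> F, v p%:R = 1,
      forall x y, x != 0 -> y != 0 -> v (x * y) = v x + v y &
      forall r x y, vge v r x -> vge v r y -> vge v r (x + y)].

(* The topological closure of Q. *)
Definition Qp (F : fieldType) (v : F -> rat) : set F :=
  [set x | forall M : nat, exists q : rat, vge v M%:R (x - ratr q)].

(* (Om, v) is an algebraic closure of the field Q_p of p-adic numbers (which is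
   the completion of Q, realized as [Qp v]), with its valuation extending the
   p-adic one. *)
Definition Qp_closure (p : nat) (Om : closedFieldType) (v : Om -> rat) : Prop :=
  [/\ padic_valuation p v,
      forall u : nat -> rat,
        (forall M : nat, exists n0 : nat, forall m n : nat,
           (n0 <= m)%N -> (n0 <= n)%N ->
           vge v M%:R (ratr (u m) - ratr (u n))) ->
        exists x : Om, forall M : nat, exists n0 : nat, forall n : nat,
          (n0 <= n)%N -> vge v M%:R (x - ratr (u n)) &
      forall x : Om, exists P : {poly Om},
        [/\ P != 0, forall i, Qp v P`_i & root P x]].

Definition decomposition (F : fieldType) (v : F -> rat) : set (fieldAut F) :=
  [set s | forall x, v (s x) = v x].

Definition inertia (F : fieldType) (v : F -> rat) (G : set (fieldAut F)) :
    set (fieldAut F) :=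
  [set s | G s /\ forall x, vge v 0 x -> vgt v 0 (s x - x)].

(* Arithmetic Frobenius elements. *)
Definition frobenius (F : fieldType) (v : F -> rat) (q : nat) :
    set (fieldAut F) :=
  [set s | decomposition v s /\
           forall x, vge v 0 x -> vgt v 0 (s x - x ^+ q)].

(* [ts] is a system of representatives of the left cosets of H in G. *)
Definition coset_transversal (gT : groupType) (G H : set gT) (ts : seq gT) : Prop :=
  (forall t, t \in ts -> G t) /\
  forall g, G g -> count (fun t => `[< H (t^-1 * g)%g >]) ts = 1%N.


Definition is_rep (gT : groupType) (F : fieldType) (n : nat)
    (G : set gT) (rho : gT -> 'M[F]_n) : Prop :=
  rho 1%g = 1%:M /\
  forall s t, G s -> G t -> rho (s * t)%g = rho s *m rho t.

Definition is_character (gT : groupType) (F : fieldType)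
    (G : set gT) (chi : gT -> F) : Prop :=
  chi 1%g = 1 /\ forall s t, G s -> G t -> chi (s * t)%g = chi s * chi t.

(* Continuity for the Krull topology and the discrete topology on [T]; for
   homomorphisms, continuity at 1 suffices. *)
Definition smooth_at1 (F : fieldType) (T : Type) (G : set (fieldAut F))
    (rho : fieldAut F -> T) : Prop :=
  exists A : seq F, forall s, G s -> (forall x, x \in A -> s x = x) ->
    rho s = rho 1%g.

(* Continuity for the Krull topology and the v-adic topology on 'M[E]_n. *)
Definition continuous_at1 (F E : fieldType) (v : E -> rat) (n : nat)
    (G : set (fieldAut F)) (rho : fieldAut F -> 'M[E]_n) : Prop :=
  forall M : nat, exists A : seq F,
    forall s, G s -> (forall x, x \in A -> s x = x) ->
    forall i k, vge v M%:R (rho s i k - rho 1%g i k).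

Definition unramified_at (F : fieldType) (p : nat)
    (rho : fieldAut algC -> 'M[F]_2) : Prop :=
  forall w : algC -> rat, padic_valuation p w ->
  forall s, inertia w (decomposition w) s -> rho s = 1%:M.

(* The representation of Gal(Qbar/Q) is attached to the weight 2 eigenform of
   level N and trivial character with Fourier coefficients a.  This determines
   the semisimplification of rho. *)
Definition attached_to (F : fieldType) (a : nat -> int) (N l : nat)
    (rho : fieldAut algC -> 'M[F]_2) : Prop :=
  forall p : nat, prime p -> ~~ (p %| N * l)%N ->
    unramified_at p rho /\
    forall (w : algC -> rat), padic_valuation p w ->
    forall s, frobenius w p s ->
      \tr (rho s) = (a p)%:~R /\ \det (rho s) = p%:R.

Definition odd_rep (F : fieldType) (rho : fieldAut algC -> 'M[F]_2) : Prop :=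
  forall c : fieldAut algC, (forall x, c x = x^*) -> \det (rho c) = -1.

Definition absolutely_irreducible (F : fieldType)
    (rho : fieldAut algC -> 'M[F]_2) : Prop :=
  forall (F' : fieldType) (i : {rmorphism F -> F'}) (u : 'cV[F']_2),
    u != 0 -> ~ (forall s, exists c : F', map_mx i (rho s) *m u = c *: u).

(* The mod l cyclotomic character, with values in a field of characteristic l:
   s z = z ^+ k for all l-th roots of unity z, where k is unique modulo l. *)
Definition cyclotomic_char (F : fieldType) (l : nat) (s : fieldAut algC) : F :=
  (xget 0%N [set k : nat | forall z : algC, z ^+ l = 1 -> s z = z ^+ k])%:R.

(* The matrix, in the basis (1, s) of the induced module, of the representation
   induced from the subgroup H, of index 2 with representatives 1 and s. *)
Definition induced_mx (gT : groupType) (F : fieldType) (H : set gT) (s : gT)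
    (chi : gT -> F) (g : gT) : 'M[F]_2 :=
  let r (i : 'I_2) : gT := if i == 0 then 1%g else s in
  \matrix_(i, k) let h := ((r i)^-1 * g * r k)%g in
                 if `[< H h >] then chi h else 0.

Definition equivalent_on (gT : groupType) (F : fieldType) (G : set gT)
    (rho rho' : gT -> 'M[F]_2) : Prop :=
  exists2 P : 'M[F]_2, P \in unitmx &
    forall g, G g -> P *m rho g = rho' g *m P.

(* Restriction to Qbar of automorphisms of an extension of Qbar. *)
Definition restrict_aut (Om : fieldType) (iota : {rmorphism algC -> Om})
    (s : fieldAut Om) : fieldAut algC :=
  xget 1%g [set t : fieldAut algC | forall x, iota (t x) = s (iota x)].

(* H^0(G, eps (x) ad^0 rho). *)
Definition H0_twisted_ad0 (gT : groupType) (F : fieldType) (G : set gT)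
    (eps : gT -> F) (rho : gT -> 'M[F]_2) : set 'M[F]_2 :=
  [set X | \tr X = 0 /\
     forall g, G g -> eps g *: (rho g *m X *m invmx (rho g)) = X].

(* [red] is the reduction map from the valuation ring of v to its residue
   field k; its values at non-integral elements are irrelevant. *)
Definition residue_map (F k : fieldType) (v : F -> rat) (red : F -> k) : Prop :=
  [/\ red 1 = 1,
      forall x y, vge v 0 x -> vge v 0 y ->
        red (x + y) = red x + red y /\ red (x * y) = red x * red y,
      forall x, vge v 0 x -> (red x == 0) = vgt v 0 x &
      forall c, exists2 x, vge v 0 x & red x = c].


Section LocalArtin.
Variables (Om : fieldType) (v : Om -> rat) (K : set Om) (q : nat).

Local Notation GK := (fixing K).

(* Open subgroups of G_K with abelian quotient; they correspond to the finite
   abelian extensions of K. *)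
Definition open_abelian (H : set (fieldAut Om)) : Prop :=
  [/\ H `<=` GK,
      H 1%g /\ (forall s t, H s -> H t -> H (s * t^-1)%g),
      exists A : seq Om, forall s, GK s -> (forall x, x \in A -> s x = x) -> H s
    & forall s t, GK s -> GK t -> H (s^-1 * t^-1 * s * t)%g].

(* The nonzero norms from the fixed field L of H down to K. *)
Definition norm_group (H : set (fieldAut Om)) : set Om :=
  [set x | exists y ts, [/\ y != 0, fixfield H y, coset_transversal GK H ts &
                            x = \prod_(t <- ts) t y]].

Definition uniformizer (pi : Om) : Prop :=
  [/\ K pi, pi != 0, 0 < v pi &
      forall x, K x -> x != 0 -> 0 < v x -> v pi <= v x].

(* [art x] is a lift to G_K of the image of x under the reciprocity map
   K^* -> G_K^ab of the local field K with residue field of cardinality q,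
   normalized by: uniformizers act as the arithmetic Frobenius on the maximal
   unramified extension.  These conditions determine that map uniquely. *)
Definition local_artin_map (art : Om -> fieldAut Om) : Prop :=
  (forall x, K x -> x != 0 -> GK (art x)) /\
  [/\ forall H x y, open_abelian H -> K x -> K y -> x != 0 -> y != 0 ->
        H ((art (x * y)%R)^-1 * (art x * art y))%g,
      forall pi x, uniformizer pi -> fixfield (inertia v GK) x -> vge v 0 x ->
        vgt v 0 (art pi x - x ^+ q),
      forall H x, open_abelian H -> K x -> x != 0 ->
        H (art x) <-> norm_group H x
    & forall H s, open_abelian H -> GK s ->
        exists x, [/\ K x, x != 0 & H ((art x)^-1 * s)%g]].

(* 1 + P^m (and O_K^* for m = 0), where e is the ramification index. *)
Definition unit_group (e m : nat) : set Om :=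
  [set x | [/\ K x, x != 0, v x = 0 & vge v (m%:R / e%:R) (x - 1)]].

Definition conductor_exponent (E : fieldType) (e : nat)
    (art : Om -> fieldAut Om) (chi : fieldAut Om -> E) (m : nat) : Prop :=
  (forall x, unit_group e m x -> chi (art x) = 1) /\
  forall n, (n < m)%N -> exists2 x, unit_group e n x & chi (art x) != 1.

End LocalArtin.

Definition character_order (gT : groupType) (F : fieldType) (G : set gT)
    (chi : gT -> F) (n : nat) : Prop :=
  [/\ (0 < n)%N, forall s, G s -> chi s ^+ n = 1 &
      forall m, (0 < m < n)%N -> exists2 s, G s & chi s ^+ m != 1].

(* The field K = Q_3(sqrt(-3)), where d ^+ 2 = -3. *)
Definition adjoin_sqrt (Om : fieldType) (v : Om -> rat) (d : Om) : set Om :=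
  [set x | exists a b, [/\ Qp v a, Qp v b & x = a + b * d]].

(* chi is a character chi_j of G_K, with values in the units of an algebraic
   closure E of Q_l, defining the type tau_{sc,3}(-3,4,6)_j as the inertial type
   of its induction to G_3. *)
Definition tau_sc3_character (Om E : fieldType) (v : Om -> rat)
    (vl : E -> rat) (d : Om) (art : Om -> fieldAut Om) (xi6 : Om) (zeta3 : E)
    (j : 'I_3) (chi : fieldAut Om -> E) : Prop :=
  let K := adjoin_sqrt v d in
  let GK := fixing K in
  [/\ is_character GK chi /\ (forall s, GK s -> chi s != 0 /\ vl (chi s) = 0),
      continuous_at1 vl GK (fun s => (chi s)%:M : 'M[E]_1),
      character_order (inertia v GK) chi 6,
      conductor_exponent v K 2 art chi 4
    & chi (art (- xi6)) = zeta3 ^+ j /\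
      chi (art (xi6 - 3%:R)) = - (zeta3 ^+ j / zeta3)].


Record wcurve (T : Type) := WCurve { wa1 : T; wa2 : T; wa3 : T; wa4 : T; wa6 : T }.

Definition wmap (T T' : Type) (f : T -> T') (E : wcurve T) : wcurve T' :=
  WCurve (f (wa1 E)) (f (wa2 E)) (f (wa3 E)) (f (wa4 E)) (f (wa6 E)).

Section Weierstrass.
Variables (A : comNzRingType) (E : wcurve A).
Let a1 := wa1 E.
Let a2 := wa2 E.
Let a3 := wa3 E.
Let a4 := wa4 E.
Let a6 := wa6 E.

Definition wb2 : A := a1 ^+ 2 + 4%:R * a2.
Definition wb4 : A := 2%:R * a4 + a1 * a3.
Definition wb6 : A := a3 ^+ 2 + 4%:R * a6.
Definition wb8 : A :=
  a1 ^+ 2 * a6 + 4%:R * a2 * a6 - a1 * a3 * a4 + a2 * a3 ^+ 2 - a4 ^+ 2.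
Definition wc4 : A := wb2 ^+ 2 - 24%:R * wb4.
Definition wdisc : A :=
  - (wb2 ^+ 2 * wb8) - 8%:R * wb4 ^+ 3 - 27%:R * wb6 ^+ 2
  + 9%:R * wb2 * wb4 * wb6.

Definition on_curve (x y : A) : bool :=
  y ^+ 2 + a1 * x * y + a3 * y == x ^+ 3 + a2 * x ^+ 2 + a4 * x + a6.
End Weierstrass.

(* E' is obtained from E by x = u^2 x' + r, y = u^3 y' + u^2 s x' + t. *)
Definition wchange (F : fieldType) (u r s t : F) (E E' : wcurve F) : Prop :=
  [/\ u * wa1 E' = wa1 E + 2%:R * s,
      u ^+ 2 * wa2 E' = wa2 E - s * wa1 E + 3%:R * r - s ^+ 2,
      u ^+ 3 * wa3 E' = wa3 E + r * wa1 E + 2%:R * t,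
      u ^+ 4 * wa4 E' = wa4 E - s * wa3 E + 2%:R * r * wa2 E
                        - (t + r * s) * wa1 E + 3%:R * r ^+ 2 - 2%:R * s * t
    & u ^+ 6 * wa6 E' = wa6 E + r * wa4 E + r ^+ 2 * wa2 E + r ^+ 3
                        - t * wa3 E - t ^+ 2 - r * t * wa1 E].

(* A global minimal Weierstrass equation of an elliptic curve over Q. *)
Definition global_minimal (E : wcurve int) : Prop :=
  wdisc E != 0 /\
  forall (E' : wcurve int) (u r s t : rat), u != 0 ->
    wchange u r s t (wmap intr E) (wmap intr E') ->
    (`|wdisc E| <= `|wdisc E'|)%R.

(* The group law on the points of E, with None the point at infinity. *)
Section GroupLaw.
Variables (F : fieldType) (E : wcurve F).

Definition wadd (P Q : option (F * F)) : option (F * F) :=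
  match P, Q with
  | None, _ => Q
  | _, None => P
  | Some (x1, y1), Some (x2, y2) =>
    if (x1 == x2) && (y1 + y2 + wa1 E * x2 + wa3 E == 0) then None else
    let lam := if x1 != x2 then (y2 - y1) / (x2 - x1)
               else (3%:R * x1 ^+ 2 + 2%:R * wa2 E * x1 + wa4 E - wa1 E * y1)
                    / (2%:R * y1 + wa1 E * x1 + wa3 E) in
    let nu := y1 - lam * x1 in
    let x3 := lam ^+ 2 + wa1 E * lam - wa2 E - x1 - x2 in
    Some (x3, - (lam + wa1 E) * x3 - nu - wa3 E)
  end.

Definition torsion_point (n : nat) : set (option (F * F)) :=
  [set P | (if P is Some (x, y) then on_curve E x y else true) /\
           iter n (wadd P) None = None].
End GroupLaw.

(* p + 1 - #E(F_p), where E also denotes the (possibly singular) reduction of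
   the given equation: for a minimal equation this is the p-th coefficient of
   the L-series of E at all primes, including those of bad reduction. *)
Definition curve_ap (E : wcurve int) (p : nat) : int :=
  p%:Z + 1 -
  (#|[set P : 'F_p * 'F_p | on_curve (wmap intr E) P.1 P.2]%SET|.+1)%:Z.

(* The reduction types below are for a minimal equation. *)
Definition additive_reduction (p : nat) (E : wcurve int) : Prop :=
  (p%:Z %| wdisc E)%Z /\ (p%:Z %| wc4 E)%Z.

(* The j-invariant c4^3 / disc is p-integral. *)
Definition potentially_good_reduction (p : nat) (E : wcurve int) : Prop :=
  exists m : int, exists2 n : int,
    ~~ (p%:Z %| n)%Z & n * wc4 E ^+ 3 = m * wdisc E.

Section Conductor.
Variable E : wcurve int.

Let EQ : wcurve algC := wmap intr E.

Definition act_point (s : fieldAut algC) (P : option (algC * algC)) :=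
  omap (fun xy => (s xy.1, s xy.2)) P.

(* The field L = Q(E[q]) and, for a place w of Qbar with ramification index e
   over Q in L, the preimages in the decomposition group of w of the
   ramification groups (in lower numbering) of L at w. *)
Definition division_field (q : nat) : set algC :=
  fixfield [set s | forall P, torsion_point EQ q P -> act_point s P = P].

Definition ramification_index (q : nat) (w : algC -> rat) (e : nat) : Prop :=
  let L := division_field q in
  [/\ (0 < e)%N, exists x, [/\ L x, x != 0 & w x = e%:R^-1] &
      forall x, L x -> x != 0 -> exists k : int, w x = k%:~R / e%:R].

Definition ramification_group (q : nat) (w : algC -> rat) (e i : nat) :
    set (fieldAut algC) :=
  [set s | decomposition w s /\
     forall x, division_field q x -> vge w 0 x ->
       vge w (i.+1%:R / e%:R) (s x - x)].

(* delta = \sum_(i >= 1) (g_i / g_0) dim (E[q] / E[q]^(G_i)), the wild part of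
   the exponent of the conductor of E at p; here w is a place over p <> q,
   idx i = [G_0 : G_i] = g_0 / g_i and dm i = dim E[q]^(G_i). *)
Definition wild_conductor (q : nat) (w : algC -> rat) (delta : rat) : Prop :=
  exists e n (idx dm : nat -> nat),
    let G := ramification_group q w e in
    [/\ ramification_index q w e,
        forall i, exists2 ts, coset_transversal (G 0%N) (G i) ts & size ts = idx i,
        forall i, exists2 pts : seq (option (algC * algC)),
          uniq pts /\ size pts = (q ^ dm i)%N &
          forall P, P \in pts <->
            torsion_point EQ q P /\ (forall s, G i s -> act_point s P = P),
        forall i, (n <= i)%N -> dm i = 2%N &
        delta = \sum_(1 <= i < n) (2 - dm i)%N%:R / (idx i)%:R].

(* 0, 1, 2 for good, multiplicative and additive reduction. *)
Definition tame_conductor (p : nat) : nat :=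
  if ~~ (p%:Z %| wdisc E)%Z then 0%N
  else if ~~ (p%:Z %| wc4 E)%Z then 1%N else 2%N.

Definition has_conductor (N : nat) : Prop :=
  (0 < N)%N /\
  forall p q : nat, prime p -> prime q -> q != p ->
  forall w : algC -> rat, padic_valuation p w ->
    wild_conductor q w ((logn p N)%:R - (tame_conductor p)%:R).

End Conductor.


Section Newforms.
Variable R : realType.
Local Notation C := (R[i]).

Definition upper_half (z : C) : Prop := 0 < complex.Im z.

Definition holomorphic_on_H (f : C -> C) : Prop :=
  forall z, upper_half z -> derivable (f : C^o -> C^o) z 1.

(* exp (2 i pi z) *)
Definition qpar (z : C) : C :=
  let r := expR (- (2%:R * pi * complex.Im z)) in
  let t := 2%:R * pi * complex.Re z in
  Complex (r * cos t) (r * sin t).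

Definition SL2Z : pred 'M[int]_2 := fun g => \det g == 1.
Definition Gamma0 (N : nat) : pred 'M[int]_2 :=
  fun g => SL2Z g && (N%:Z %| g 1%R 0%R)%Z.

Definition slash2 (f : C -> C) (g : 'M[int]_2) (z : C) : C :=
  let den := (g 1 0)%:~R * z + (g 1 1)%:~R in
  f (((g 0 0)%:~R * z + (g 0 1)%:~R) / den) / den ^+ 2.

Definition vanishes_at_infinity (f : C -> C) : Prop :=
  forall e : R, 0 < e -> exists Y : R, forall z,
    upper_half z -> Y < complex.Im z -> `|f z| < e%:C%C.

Definition cusp_form (N : nat) (f : C -> C) : Prop :=
  [/\ holomorphic_on_H f,
      forall g z, Gamma0 N g -> upper_half z -> slash2 f g z = f z &
      forall g, SL2Z g -> vanishes_at_infinity (slash2 f g)].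

Definition fundamental_domain : set (R * R) :=
  [set xy | [/\ `|xy.1| <= 2%:R^-1, 0 < xy.2 & 1 <= xy.1 ^+ 2 + xy.2 ^+ 2]].

Definition coset_reps (N : nat) (rs : seq 'M[int]_2) : Prop :=
  all SL2Z rs /\
  forall g, SL2Z g -> count (fun r => Gamma0 N (g *m invmx r)) rs = 1%N.

(* The Petersson product on S_2(Gamma0(N)), up to a positive constant: the
   integral of f * conj g * y^2 dx dy / y^2 over the translates, by
   representatives of Gamma0(N) \ SL2(Z), of the fundamental domain. *)
Definition petersson (rs : seq 'M[int]_2) (f g : C -> C) : C :=
  let mu := (@lebesgue_measure R \x @lebesgue_measure R)%E in
  let h r (xy : R * R) :=
    let z := Complex xy.1 xy.2 in slash2 f r z * (slash2 g r z)^* in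
  \sum_(r <- rs)
    Complex (Rintegral mu fundamental_domain (fun xy => complex.Re (h r xy)))
            (Rintegral mu fundamental_domain (fun xy => complex.Im (h r xy))).

(* f is orthogonal to the forms g(dz), with g of level M and d M | N, M < N. *)
Definition orthogonal_to_oldforms (N : nat) (f : C -> C) : Prop :=
  forall (M d : nat) (g : C -> C) rs,
    (d * M %| N)%N -> (M < N)%N -> cusp_form M g -> coset_reps N rs ->
    petersson rs f (fun z => g (d%:R * z)) = 0.

(* The operator T_p of level N in weight 2 (also written U_p when p | N). *)
Definition hecke (N p : nat) (f : C -> C) (z : C) : C :=
  (\sum_(b < p) f ((z + b%:R) / p%:R)) / p%:R +
  (if (p %| N)%N then 0 else p%:R * f (p%:R * z)).

(* f is a normalized newform of weight 2 on Gamma0(N) with (integral) Fourier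
   coefficients a. *)
Definition newform (N : nat) (f : C -> C) (a : nat -> int) : Prop :=
  [/\ (0 < N)%N /\ cusp_form N f,
      orthogonal_to_oldforms N f,
      forall p, prime p -> exists c : C, forall z, upper_half z ->
        hecke N p f z = c * f z,
      forall z, upper_half z ->
        (fun n : nat => \sum_(k < n) (a k)%:~R * qpar z ^+ k : C^o) @ \oo
          --> (f z : C^o)
    & a 1%N = 1].

End Newforms.

(* The newform with coefficients a corresponds to E, given by a global minimal
   equation: L(f, s) = L(E, s). *)
Definition corresponds (a : nat -> int) (E : wcurve int) : Prop :=
  forall p, prime p -> a p = curve_ap E p.

(* Main.v *)
(* Let g be the image under the Artin map of the uniformizer d = sqrt(-3) of K.
   It fixes K and acts on the l-th roots of unity, which generate an unramified
   extension, by x -> x^3; hence eps(g) = 3.  In a basis adapted to the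
   induction, rho(g) is diagonal and rho(s) antidiagonal.  If X is invariant
   under the twisted action, then g kills its diagonal entries (as 3 <> 1 mod l)
   and the product of its off-diagonal ones (as 9 <> 1 mod l, since l >= 5),
   while s exchanges the off-diagonal entries up to nonzero factors; so X = 0. *)
Require Import Defs.
From HB Require Import structures.
From mathcomp Require Import all_boot all_order all_fingroup all_algebra all_field.
From mathcomp Require Import complex.
From mathcomp Require Import all_classical all_reals all_analysis.
From mathcomp Require Import zify ring.

Set Implicit Arguments.
Unset Strict Implicit.
Unset Printing Implicit Defensive.

Import Order.TTheory GRing.Theory Num.Theory.

Local Open Scope classical_set_scope.
Local Open Scope ring_scope.

(** * Field automorphisms as ring morphisms *)

Section AutMorphism.
Variables (F : fieldType) (s : fieldAut F).

Lemma aut_zmod_morphism : GRing.zmod_morphism (aut_fun s).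
Proof.
have /asboolP [_ _ _ fD _] := autpP s.
by move=> x y; apply: (addIr (aut_fun s y)); rewrite subrK -[LHS]fD subrK.
Qed.

Lemma aut_monoid_morphism : GRing.monoid_morphism (aut_fun s).
Proof. by have /asboolP [_ _ f1 _ fM] := autpP s. Qed.

HB.instance Definition _ :=
  GRing.isZmodMorphism.Build F F (aut_fun s) aut_zmod_morphism.
HB.instance Definition _ :=
  GRing.isMonoidMorphism.Build F F (aut_fun s) aut_monoid_morphism.

End AutMorphism.

(** * Valuations extending the p-adic one in characteristic zero *)

Section Valuation.
Variables (F : fieldType) (p : nat) (v : F -> rat).
Hypothesis p_pr : prime p.
Hypothesis hv : padic_valuation p v.
Hypothesis char0 : [pchar F] =i pred0.

Lemma valM x y : x != 0 -> y != 0 -> v (x * y) = v x + v y.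
Proof. by case: hv => _ _ + _; apply. Qed.

Lemma val1 : v 1 = 0.
Proof.
have := valM (oner_neq0 F) (oner_neq0 F).
by rewrite mulr1 => /eqP; rewrite -subr_eq0 opprD addrA subrr sub0r oppr_eq0 => /eqP.
Qed.

Lemma valX x n : x != 0 -> v (x ^+ n) = v x *+ n.
Proof.
move=> x0; elim: n => [|n IHn]; first by rewrite expr0 val1.
by rewrite exprS valM ?expf_neq0 // IHn mulrS.
Qed.

Lemma val_eq0_root x n : (0 < n)%N -> x ^+ n = 1 -> v x = 0.
Proof.
move=> n0 xn; have x0 : x != 0.
  by apply/eqP => x0; move/eqP: xn; rewrite x0 expr0n gtn_eqF // eq_sym oner_eq0.
by have /eqP := valX n x0; rewrite xn val1 eq_sym mulrn_eq0 gtn_eqF // => /eqP.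
Qed.

Lemma valN x : v (- x) = v x.
Proof.
have [->|x0] := eqVneq x 0; first by rewrite oppr0.
have N1 : v (-1) = 0 by apply: (@val_eq0_root _ 2) => //; rewrite sqrrN expr1n.
by rewrite -mulN1r valM ?oppr_eq0 ?oner_eq0 // N1 add0r.
Qed.

Lemma vgeD r x y : vge v r x -> vge v r y -> vge v r (x + y).
Proof. by case: hv => _ _ _; apply. Qed.

Lemma vgeM x y : vge v 0 x -> vge v 0 y -> vge v 0 (x * y).
Proof.
rewrite /vge mulf_eq0; case: (eqVneq x 0) => //= x0; case: (eqVneq y 0) => //= y0.
by move=> ? ?; rewrite valM // addr_ge0.
Qed.

Lemma vgeX x n : vge v 0 x -> vge v 0 (x ^+ n).
Proof.
move=> hx; elim: n => [|n IHn]; last by rewrite exprS vgeM.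
by rewrite expr0 /vge val1 lexx orbT.
Qed.

Lemma vge_nat n : vge v 0 n%:R.
Proof.
elim: n => [|n IHn]; first by rewrite /vge eqxx.
by rewrite mulrS vgeD // /vge val1 lexx orbT.
Qed.

Lemma vgtN r x : vgt v r (- x) = vgt v r x.
Proof. by rewrite /vgt oppr_eq0 valN. Qed.

Lemma vgtD r x y : vgt v r x -> vgt v r y -> vgt v r (x + y).
Proof.
rewrite {1 2}/vgt; have [->|x0 /= hx] := eqVneq x 0; first by rewrite add0r.
have [->|y0 /= hy] := eqVneq y 0; first by rewrite addr0 /vgt hx orbT.
(* The strict bound comes from the non-strict one at the smaller of the two values, which already
   exceeds [r]. *)
have /orP [xy0|] : vge v (Num.min (v x) (v y)) (x + y).
  by apply: vgeD; rewrite /vge ge_min lexx ?orbT.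
  by rewrite /vgt xy0.
rewrite /vgt => h; apply/orP; right; apply: (lt_le_trans _ h).
by rewrite lt_min hx hy.
Qed.

Lemma vgtB r x y : vgt v r x -> vgt v r y -> vgt v r (x - y).
Proof. by move=> hx hy; rewrite vgtD // vgtN. Qed.

Lemma vgtM x y : vgt v 0 x -> vge v 0 y -> vgt v 0 (x * y).
Proof.
rewrite /vgt /vge mulf_eq0; case: (eqVneq x 0) => //= x0; case: (eqVneq y 0) => //= y0.
by move=> ? ?; rewrite valM // ltr_wpDr.
Qed.

(** Were [x + y] zero or of value above [v x], then [x = (x + y) - y] would have value above its
    own. *)
Lemma val_addl x y : x != 0 -> vgt v (v x) y -> x + y != 0 /\ v (x + y) = v x.
Proof.
move=> x0 hy.
have xy0 : x + y != 0.
  apply/eqP => /eqP; rewrite addr_eq0 => /eqP xE.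
  by move: hy; rewrite -[y]opprK -xE vgtN /vgt (negbTE x0) ltxx.
split=> //; apply/eqP; rewrite eq_le andbC; apply/andP; split.
  have : vge v (v x) (x + y).
    apply: vgeD; first by rewrite /vge lexx orbT.
    by move: hy; rewrite /vgt /vge => /orP [->//|/ltW ->]; rewrite orbT.
  by rewrite /vge (negbTE xy0).
rewrite leNgt; apply/negP => h.
have : vgt v (v x) (x + y - y) by rewrite vgtB // /vgt h orbT.
by rewrite addrK /vgt (negbTE x0) ltxx.
Qed.

Let natF0 n : (n%:R == 0 :> F) = (n == 0%N).
Proof. exact: ((pcharf0P F).1 char0 n). Qed.

(** Bezout gives [u * n = 1 + w * p], of value 0; the values of [u] and [n] are nonnegative with sum
    0, so both vanish. *)
Lemma val_nat_coprime n : coprime p n -> v n%:R = 0.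
Proof.
move=> cpn; have n0 : (0 < n)%N.
  by case: n cpn => //; rewrite /coprime gcdn0 => /eqP p1; move: p_pr; rewrite p1.
have [u w uw _] := egcdnP p n0.
move: uw; rewrite gcdnC (eqP cpn) => uw.
have p0 : p%:R != 0 :> F by case: hv.
have [_ v1] : 1 + (w * p)%:R != 0 :> F /\ v (1 + (w * p)%:R) = v 1.
  apply: val_addl; rewrite ?oner_eq0 // val1 natrM mulrC vgtM ?vge_nat //.
  by rewrite /vgt; case: hv => _ -> _ _; rewrite ltr01 orbT.
have u0 : (0 < u)%N by case: u uw => //; rewrite mul0n addn1.
have nF0 : n%:R != 0 :> F by rewrite natF0 -lt0n.
have uF0 : u%:R != 0 :> F by rewrite natF0 -lt0n.
have : v u%:R + v n%:R = 0.
  by rewrite -valM // -natrM uw addnC natrD v1 val1.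
have := vge_nat u; have := vge_nat n; rewrite /vge (negbTE nF0) (negbTE uF0) /=.
by move=> hn hu /eqP; rewrite paddr_eq0 // => /andP [_ /eqP].
Qed.

Lemma val_nat_int n : (0 < n)%N -> exists m : nat, v n%:R = m%:R.
Proof.
move=> n0; exists (logn p n).
have p0 : p%:R != 0 :> F by case: hv.
have [m cpm Dn] := pfactor_coprime p_pr n0.
have m0 : (0 < m)%N.
  by move: n0; rewrite Dn muln_gt0 => /andP [].
rewrite [in LHS]Dn natrM valM; last first.
- by rewrite natF0 -lt0n expn_gt0 prime_gt0.
- by rewrite natF0 -lt0n.
by rewrite val_nat_coprime // add0r natrX valX //; case: hv => _ -> _ _.
Qed.

(** A rational close enough to [x] has the same value, and nonzero rationals have integral
    values. *)
Lemma val_Qp_int x : Qp v x -> x != 0 -> exists m : int, v x = m%:~R.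
Proof.
move=> Qx x0.
(* This precision exceeds [v x], so [val_addl] applies to the error. *)
have [q hq] := Qx (Num.bound `|v x|).
have {}hq : vgt v (v x) (x - ratr q).
  move: hq; rewrite /vge /vgt => /orP [->//|h]; apply/orP; right.
  apply: (lt_le_trans _ h).
  exact: le_lt_trans (ler_norm _) (archi_boundP (normr_ge0 _)).
have [q0 vq] : x + - (x - ratr q) != 0 /\ v (x + - (x - ratr q)) = v x.
  by apply: val_addl; rewrite ?vgtN.
move: q0 vq; rewrite opprB addrC subrK => q0 <-.
have valZ (z : int) : z != 0 -> z%:~R != 0 :> F /\ exists m : int, v z%:~R = m%:~R.
  move=> z0; have [m vm] := @val_nat_int `|z|%N ltac:(by rewrite absz_gt0).
  have hz : z%:~R = `|z|%N%:R :> F \/ z%:~R = - `|z|%N%:R :> F.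
    by case: (intP z) => [|n|n]; [left|left|right]; rewrite ?abszN ?mulrNz.
  split; first by case: hz => ->; rewrite ?oppr_eq0 natF0 absz_eq0.
  by exists m%:Z; case: hz => ->; rewrite ?valN vm.
have qn0 : numq q != 0.
  by apply: contra q0 => /eqP q0; rewrite /ratr q0 mul0r.
have [n0 [n vn]] := valZ _ qn0.
have [e0 [e ve]] := valZ _ (denq_neq0 q).
exists (n - e); rewrite intrB -vn -ve.
by apply: (addIr (v (denq q)%:~R)); rewrite subrK -valM // /ratr divfK.
Qed.

(** Here [v d] is 1/2. In [a + b * d] the first term has integral value and the second a value in
    1/2 + Z, so no cancellation occurs and all values are half-integers. Doubling keeps the argument
    in the integers. *)
Lemma sqrt_uniformizer (d : F) : d ^+ 2 = - p%:R ->
  uniformizer v (adjoin_sqrt v d) d.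
Proof.
move=> d2; have p0 : p%:R != 0 :> F by case: hv.
have d0 : d != 0.
  by apply: contra p0 => /eqP d0; move: d2; rewrite d0 expr0n /= => /esym/eqP; rewrite oppr_eq0.
have vd : v d *+ 2 = 1 by rewrite -valX // d2 valN; case: hv.
have vd_gt0 : 0 < v d by rewrite -(pmulrn_lgt0 _ (isT : (0 < 2)%N)) vd ltr01.
have Qint (z : int) : Qp v z%:~R.
  by move=> M; exists z%:~R; rewrite ratr_int subrr /vge eqxx.
split=> //; first by exists 0, 1; split; [exact: (Qint 0)|exact: (Qint 1)|rewrite add0r mul1r].
have key x : adjoin_sqrt v d x -> x != 0 -> exists m : int, v x *+ 2 = m%:~R.
  have H1 a : Qp v a -> a != 0 -> exists m : int, v a *+ 2 = (m *+ 2)%:~R.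
    by move=> /val_Qp_int h /h [m ->]; exists m; rewrite rmorphMn.
  have H2 b : Qp v b -> b != 0 -> exists m : int, v (b * d) *+ 2 = (m *+ 2 + 1)%:~R.
    move=> /val_Qp_int h b0; have [m vb] := h b0.
    by exists m; rewrite valM // mulrnDl vd vb rmorphD rmorphMn.
  move=> [a [b [Qa Qb ->]]].
  have [->|a0] := eqVneq a 0.
    rewrite add0r => bd0; have [|m ->] := H2 b Qb; last by eexists.
    by apply: contra bd0 => /eqP->; rewrite mul0r.
  have [->|b0] := eqVneq b 0.
    by rewrite mul0r addr0; have [m ->] := H1 a Qa a0; eexists.
  move=> _; have [m1 h1] := H1 a Qa a0; have [m2 h2] := H2 b Qb b0.
  have [h|h|h] := ltgtP (v a) (v (b * d)).
  - have [|_ ->] := @val_addl a (b * d) a0; first by rewrite /vgt h orbT.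
    by rewrite h1; eexists.
  - have [||_] := @val_addl (b * d) a; [exact: mulf_neq0|by rewrite /vgt h orbT|].
    by rewrite addrC => ->; rewrite h2; eexists.
  (* Equal values would make an even integer equal to an odd one. *)
  - by move: h1; rewrite h h2 => /(mulrIz (oner_neq0 rat)); lia.
move=> x Kx x0 vx; have [m vm] := key x Kx x0.
rewrite -(ler_pMn2r (isT : (0 < 2)%N)) vd vm -[1]/(1%:~R) ler_int.
by have : 0 < v x *+ 2 by [rewrite pmulrn_lgt0]; rewrite vm ltr0z.
Qed.

(* If u = z / w <> 1, then 0 = sum_(i < n) u ^ i is congruent to n, a unit. *)
Lemma root_of_unity_val_inj n z w : coprime p n -> (0 < n)%N ->
  z ^+ n = 1 -> w ^+ n = 1 -> vgt v 0 (z - w) -> z = w.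
Proof.
move=> cpn n0 zn wn zw; apply/eqP/negPn/negP => neq.
have w0 : w != 0.
  by apply/eqP => w0; move/eqP: wn; rewrite w0 expr0n gtn_eqF // eq_sym oner_eq0.
pose u := z / w.
have un : u ^+ n = 1 by rewrite expr_div_n zn wn divr1.
have vint x : x ^+ n = 1 -> vge v 0 x.
  by move=> xn; rewrite /vge (val_eq0_root n0 xn) lexx orbT.
have u1 : vgt v 0 (1 - u).
  rewrite -vgtN opprB; have -> : u - 1 = (z - w) * w^-1 by rewrite mulrBl divff.
  by rewrite vgtM // vint // exprVn wn invr1.
have u1n : u != 1 by rewrite /u -(divff w0) (inj_eq (mulIf _)) // invr_eq0.
have sum0 : \sum_(i < n) u ^+ i = 0.
  have /esym/eqP := subrX1 u n; rewrite un subrr mulf_eq0 subr_eq0 (negbTE u1n) /=.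
  by move/eqP.
have : vgt v 0 n%:R.
  have -> : n%:R = \sum_(i < n) (1 - u ^+ i).
    by rewrite sumrB sum0 subr0 sumr_const card_ord.
  elim/big_ind: _ => [|x y|i _]; [by rewrite /vgt eqxx|exact: vgtD|].
  rewrite -vgtN opprB subrX1 -opprB mulNr vgtN vgtM //.
  elim/big_ind: _ => [|x y|k _]; [by rewrite /vge eqxx|exact: vgeD|].
  exact/vgeX/vint.
by rewrite /vgt natF0 gtn_eqF //= val_nat_coprime // ltxx.
Qed.

End Valuation.

(** * Restriction to [algC] and the cyclotomic character *)

Lemma restrict_autP (Om : fieldType) (iota : {rmorphism algC -> Om})
  (s : fieldAut Om) (x : algC) : iota (restrict_aut iota s x) = s (iota x).
Proof.
(* [restrict_aut] is a choice, so one restriction has to be exhibited; its inverse will be the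
   restriction of [s^-1]. *)
suff [t ht] : exists t : fieldAut algC, forall x, iota (t x) = s (iota x).
  pose T := [set t : fieldAut algC | forall x, iota (t x) = s (iota x)].
  exact: (@xgetPex _ 1%g T (ex_intro _ t ht)).
(* [r] permutes the roots of the rational polynomial [minCpoly y], which splits over [algC], so
   these roots all lie in the image of [iota]. *)
have lift (r : fieldAut Om) : {f : algC -> algC | forall x, iota (f x) = r (iota x)}.
  suff h y : exists z, iota z = r (iota y).
    by have [f hf] := choice h; exists f.
  have [q [Dq _] _] := minCpolyP y.
  have [rs Drs] := closed_field_poly_normal (minCpoly y).
  have : root (map_poly iota (minCpoly y)) (r (iota y)).
    have -> : map_poly iota (minCpoly y) = map_poly r (map_poly iota (minCpoly y)).
      rewrite Dq -!map_poly_comp; apply: eq_map_poly => c /=.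
      by rewrite !fmorph_rat.
    by rewrite !fmorph_root root_minCpoly.
  have := minCpoly_monic y; rewrite monicE => /eqP lc1.
  rewrite Drs lc1 scale1r map_prod_XsubC.
  rewrite -(big_map iota predT (fun z => 'X - z%:P)) root_prod_XsubC => /mapP [z _ ->].
  by exists z.
have [f hf] := lift s; have [g hg] := lift s^-1%g.
have /asboolP [sK sVK s1 sD sM] := autpP s.
suff P : `[< is_field_aut (f, g) >] by exists (FieldAut P).
apply/asboolP; split=> /=.
- by move=> y; apply: (fmorph_inj iota); rewrite hg hf; exact: sK.
- by move=> y; apply: (fmorph_inj iota); rewrite hf hg; exact: sVK.
- by apply: (fmorph_inj iota); rewrite hf (rmorph1 iota); exact: s1.
- by move=> y z; apply: (fmorph_inj iota); rewrite (rmorphD iota) !hf (rmorphD iota); exact: sD.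
- by move=> y z; apply: (fmorph_inj iota); rewrite (rmorphM iota) !hf (rmorphM iota); exact: sM.
Qed.

(** Evaluating at a primitive root shows that the chosen exponent agrees with [m] modulo [l], hence
    in [F]. *)
Lemma cyclotomic_charE (F : fieldType) (l m : nat) (t : fieldAut algC) :
  (0 < l)%N -> l%:R = 0 :> F -> (forall z : algC, z ^+ l = 1 -> t z = z ^+ m) ->
  cyclotomic_char F l t = m%:R.
Proof.
move=> l_gt0 l0 ht; rewrite /cyclotomic_char; set K := [set k | _].
have [z zP] := C_prim_root_exists l_gt0.
have zl := prim_expr_order zP.
have := @xgetPex _ 0%N K (ex_intro _ m ht) z zl; rewrite (ht z zl).
move/eqP; rewrite (eq_prim_root_expr zP) => /eqP e.
have modE n : n%:R = (n %% l)%:R :> F.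
  by rewrite {1}(divn_eq n l) natrD natrM l0 mulr0 add0r.
by rewrite modE -e -modE.
Qed.

(** * The Artin map at the uniformizer [d] *)

Lemma adjoin_sqrt_sup (F : fieldType) (v : F -> rat) (d x : F) :
  Qp v x -> adjoin_sqrt v d x.
Proof.
move=> Qx; exists x, 0; split; rewrite ?mul0r ?addr0 // => M; exists 0.
by rewrite (ratr_int F 0) subr0 /vge eqxx.
Qed.

(** Roots of unity of order prime to [p] stay distinct modulo the maximal ideal. Hence inertia fixes
    [z], and the Frobenius congruence for [art d] becomes an equality. *)
Lemma art_sqrt_root_of_unity (p n : nat) (Om : fieldType) (v : Om -> rat) (d : Om)
    (art : Om -> fieldAut Om) (z : Om) :
  prime p -> padic_valuation p v -> [pchar Om] =i pred0 ->
  d ^+ 2 = - p%:R -> local_artin_map v (adjoin_sqrt v d) p art ->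
  coprime p n -> (0 < n)%N -> z ^+ n = 1 -> art d z = z ^+ p.
Proof.
move=> p_pr hv char0 d2 [_ [_ artU _ _]] cpn n0 zn.
have vz y : y ^+ n = 1 -> vge v 0 y.
  by move=> yn; rewrite /vge (val_eq0_root hv n0 yn) lexx orbT.
have inj := root_of_unity_val_inj p_pr hv char0 cpn n0.
have autn (t : fieldAut Om) : t z ^+ n = 1 by rewrite -(rmorphXn t) zn (rmorph1 t).
apply: (inj); [exact: autn|by rewrite exprAC zn expr1n|].
apply: artU (vz z zn); first exact: (sqrt_uniformizer p_pr hv char0 d2).
by move=> t [_ ht]; apply: (inj _ _ (autn t) zn); exact: ht (vz z zn).
Qed.

(** * Two-by-two matrices *)

Lemma det2 (k : comNzRingType) (A : 'M[k]_2) :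
  \det A = A 0 0 * A 1 1 - A 0 1 * A 1 0.
Proof.
rewrite (expand_det_row _ 0) !big_ord_recl big_ord0 addr0 /cofactor /=.
rewrite ![\det _]det_mx11 !mxE /= expr0 expr1 mul1r mulN1r mulrN.
by congr (_ * A _ _ - A _ _ * A _ _); apply: val_inj.
Qed.

(* The diagonal and the antidiagonal matrices trace zero parts: A scales the
   entries of X by a, a t and a / t, while B exchanges the last two. *)
Lemma twisted_ad0_eq0 (k : fieldType) (a e : k) (A B X : 'M[k]_2) :
  \tr X = 0 -> a != 1 -> a ^+ 2 != 1 ->
  A \in unitmx -> A 0 1 = 0 -> A 1 0 = 0 ->
  B \in unitmx -> B 0 0 = 0 -> B 1 1 = 0 ->
  X *m A = a *: (A *m X) -> X *m B = e *: (B *m X) -> X = 0.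
Proof.
move=> trX a1 a21; rewrite !unitmxE !unitfE !det2.
move=> + A01 A10 + B00 B11 XA XB; rewrite A01 B00 !mul0r subr0 sub0r oppr_eq0.
rewrite !mulf_eq0 !negb_or => /andP [A0 A1] /andP [B0 B1].
have sumE (F : 'I_2 -> k) : \sum_i F i = F 0 + F 1.
  by rewrite !big_ord_recl big_ord0 addr0; congr (_ + F _); apply: val_inj.
have mulE (P Q : 'M[k]_2) i1 i2 : (P *m Q) i1 i2 = P i1 0 * Q 0 i2 + P i1 1 * Q 1 i2.
  by rewrite mxE sumE.
have X11 : X 1 1 = - X 0 0.
  by apply/eqP; rewrite -addr_eq0 addrC; apply/eqP; rewrite -trX /mxtrace sumE.
have ent (P Q : 'M[k]_2) i1 i2 : P = Q -> P i1 i2 = Q i1 i2 by move->.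
have := ent _ _ 0 0 XA; have := ent _ _ 0 1 XA; have := ent _ _ 1 0 XA.
have := ent _ _ 0 0 XB; have := ent _ _ 1 1 XB.
rewrite !mxE !sumE A01 A10 B00 B11 X11 !(mulr0, mul0r, addr0, add0r).
set x := X 0 0; set b := X 0 1; set c := X 1 0 => cB bB cA bA xA.
have x0 : x = 0.
  have : (1 - a) * A 0 0 * x = 0.
    have -> : (1 - a) * A 0 0 * x = x * A 0 0 - a * (A 0 0 * x) by ring.
    by rewrite xA subrr.
  by move/eqP; rewrite !mulf_eq0 subr_eq0 eq_sym (negbTE a1) (negbTE A0) => /eqP.
(* One off-diagonal relation alone allows a nonzero entry if the diagonal entries of [A] have ratio
   [a] or its inverse; the product of both relations eliminates this ratio. *)
have bc0 : b * c = 0.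
  have : (1 - a ^+ 2) * (A 0 0 * A 1 1) * (b * c) = 0.
    have -> : (1 - a ^+ 2) * (A 0 0 * A 1 1) * (b * c) =
      (b * A 1 1) * (c * A 0 0) - (a * (A 0 0 * b)) * (a * (A 1 1 * c)) by ring.
    by rewrite bA cA subrr.
  move/eqP; rewrite !mulf_eq0 subr_eq0 eq_sym (negbTE a21) (negbTE A0) (negbTE A1) /=.
  by rewrite -mulf_eq0 => /eqP.
have [b0 c0] : b = 0 /\ c = 0.
  move/eqP: bc0; rewrite mulf_eq0 => /orP [] /eqP z0; split=> //.
    by move/eqP: cB; rewrite z0 !mulr0 mulf_eq0 (negbTE B0) orbF => /eqP.
  by move/eqP: bB; rewrite z0 !mulr0 mulf_eq0 (negbTE B1) orbF => /eqP.
apply/matrixP => i1 i2; rewrite mxE.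
have ordP (i : 'I_2) : i = 0 \/ i = 1.
  by case: i => [[|[|?]]] // ?; [left|right]; apply: val_inj.
by case: (ordP i1) => ->; case: (ordP i2) => ->; rewrite ?X11 -/x -/b -/c ?x0 ?oppr0.
Qed.

(** * Vanishing of the twisted invariants at 3 *)

Theorem proposition5p1
  (* the newform f, with Fourier coefficients a, and the curve E_f *)
  (R : realType) (N : nat) (f : R[i] -> R[i]) (a : nat -> int)
  (Ef : wcurve int)
  (f_newform : newform N f a)
  (Ef_minimal : global_minimal Ef)
  (Ef_conductor : has_conductor Ef N)
  (f_Ef : corresponds a Ef)
  (* the residual representation *)
  (l : nat) (l_prime : prime l) (l_ge5 : (5 <= l)%N) (l_N : ~~ (l %| N)%N)
  (f_ordinary : ~~ (l%:Z %| a l)%Z)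
  (S : seq nat) (S_prime : forall p, p \in S -> prime p)
  (S_bad : forall p, prime p -> (p %| N * l)%N -> p \in S)
  (kappa : finFieldType) (kappa_char : l \in [pchar kappa])
  (rhobar : fieldAut algC -> 'M[kappa]_2)
  (rhobar_rep : is_rep setT rhobar)
  (rhobar_continuous : smooth_at1 setT rhobar)
  (rhobar_S : forall p, prime p -> p \notin S -> unramified_at p rhobar)
  (rhobar_attached : attached_to a N l rhobar)
  (rhobar_odd : odd_rep rhobar)
  (rhobar_irr : absolutely_irreducible rhobar)
  (* the l-adic representation attached to f, over an algebraic closure E of
     Q_l with residue field k *)
  (E : closedFieldType) (vl : E -> rat) (E_Ql : Qp_closure l vl)
  (k : fieldType) (red : E -> k) (red_residue : residue_map vl red)
  (rho : fieldAut algC -> 'M[E]_2)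
  (rho_rep : is_rep setT rho)
  (rho_continuous : continuous_at1 vl setT rho)
  (rho_attached : attached_to a N l rho)
  (* the prime 3: Om is an algebraic closure of Q_3, d = sqrt(-3), and s
     induces the nontrivial element of Gal(K/Q_3) *)
  (N_9 : (9 %| N)%N)
  (Ef_additive : additive_reduction 3 Ef)
  (Ef_potentially_good : potentially_good_reduction 3 Ef)
  (Om : closedFieldType) (v : Om -> rat) (Om_Q3 : Qp_closure 3 v)
  (iota : {rmorphism algC -> Om})
  (d : Om) (d_sqrt : d ^+ 2 = - 3%:R)
  (s : fieldAut Om) (s_G3 : fixing (Qp v) s) (s_d : s d = - d)
  (art : Om -> fieldAut Om)
  (art_artin : local_artin_map v (adjoin_sqrt v d) 3 art)
  (xi6 : Om) (xi6_prim : 6.-primitive_root xi6) (xi6_K : adjoin_sqrt v d xi6)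
  (zeta3 : E) (zeta3_prim : 3.-primitive_root zeta3)
  (* the inertial type at 3 is tau_{sc,3}(-3,4,6)_j *)
  (j : 'I_3) (chi : fieldAut Om -> E)
  (chi_tau : tau_sc3_character v vl d art xi6 zeta3 j chi)
  (inertial_type :
     equivalent_on (inertia v (fixing (Qp v)))
       (rho \o restrict_aut iota)
       (induced_mx (fixing (adjoin_sqrt v d)) s chi))
  (i : {rmorphism kappa -> k})
  (residual_type :
     equivalent_on (fixing (Qp v))
       (map_mx i \o (rhobar \o restrict_aut iota))
       (induced_mx (fixing (adjoin_sqrt v d)) s (red \o chi)))
  (chibar_conj : exists2 g, fixing (adjoin_sqrt v d) g &
     red (chi g) <> red (chi (s * g * s^-1)%g)) :
  H0_twisted_ad0 (fixing (Qp v))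
    (cyclotomic_char kappa l \o restrict_aut iota)
    (rhobar \o restrict_aut iota) = [set 0].
Proof.
have [p3 _ _] := Om_Q3.
have charOm : [pchar Om] =i pred0.
  by apply/pcharf0P => n; rewrite -(rmorph_nat iota) fmorph_eq0 pnatr_eq0.
have natk n : (n < l)%N -> (0 < n)%N -> n%:R != 0 :> k.
  move=> nl n0; rewrite -(rmorph_nat i) fmorph_eq0 -(dvdn_pcharf kappa_char).
  by rewrite gtnNdvd.
(* This is 3 ^ 2 - 1. Since [l] may be 5 or 7, [natk] does not cover it, but 8 is a power of 2 and
   [l] is odd. *)
have l8 : 8%:R != 0 :> k.
  rewrite -(rmorph_nat i) fmorph_eq0 -(dvdn_pcharf kappa_char).
  by rewrite (_ : 8 = 2 ^ 3)%N // Euclid_dvdX // andbT gtnNdvd // (leq_trans _ l_ge5).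
have d0 : d != 0.
  apply/eqP => d0; move/eqP: d_sqrt; rewrite d0 expr0n /= eq_sym oppr_eq0.
  by rewrite ((pcharf0P Om).1 charOm).
have dN : - d != d.
  by rewrite -subr_eq0 -opprD oppr_eq0 -mulr2n -mulr_natl mulf_eq0 ((pcharf0P Om).1 charOm).
have Kd : adjoin_sqrt v d d by have [] := sqrt_uniformizer (isT : prime 3) p3 charOm d_sqrt.
have gK : fixing (adjoin_sqrt v d) (art d) by have [h _] := art_artin; apply: h.
set g := art d in gK *.
have gG : fixing (Qp v) g by move=> x /(adjoin_sqrt_sup d) /gK.
have gd : g d = d := gK d Kd.
have sVd : (s^-1)%g d = - d.
  have : (s^-1 * s)%g d = d by rewrite mulVg.
  by rewrite -[LHS]/((s^-1)%g (s d)) s_d (rmorphN (aut_fun s^-1%g)) => /eqP;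
    rewrite eqr_oppLR => /eqP.
(* Such a [t] selects the default value 0 in [induced_mx]. *)
have notK (t : fieldAut Om) : t d = - d -> `[< fixing (adjoin_sqrt v d) t >] = false.
  by move=> td; apply/asboolP => /(_ d Kd); rewrite td => /eqP; rewrite (negbTE dN).
have eps_g : cyclotomic_char kappa l (restrict_aut iota g) = 3%:R.
  apply: cyclotomic_charE; [exact: prime_gt0|exact: pcharf0|] => z zl.
  apply: (fmorph_inj iota); rewrite restrict_autP rmorphXn.
  apply: (art_sqrt_root_of_unity (isT : prime 3) p3 charOm d_sqrt art_artin (n := l)).
  - by rewrite prime_coprime // dvdn_prime2 // neq_ltn (leq_trans _ l_ge5).
  - exact: prime_gt0.
  - by rewrite -rmorphXn zl rmorph1.
have rho_unit t : rhobar t \in unitmx.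
  have [rho1 rhoM] := rhobar_rep.
  by have /mulmx1_unit [] : rhobar t *m rhobar t^-1%g = 1%:M by rewrite -rhoM // mulgV.
have [P Pu PE] := residual_type.
apply/seteqP; split=> [X [trX invX]|_ ->] /=; last first.
  by split=> [|t _]; rewrite ?mxtrace0 // mulmx0 mul0mx scaler0.
pose ind := induced_mx (fixing (adjoin_sqrt v d)) s (red \o chi).
have ind_unit t : fixing (Qp v) t -> ind t \in unitmx.
  move=> /PE tE; have : P *m map_mx i (rhobar (restrict_aut iota t)) \in unitmx.
    by rewrite unitmx_mul Pu map_unitmx rho_unit.
  by rewrite tE unitmx_mul => /andP [].
(* [X] over [k], in the basis adapted to the induction; [i] and conjugation by [P] are injective, so
   [Y = 0] suffices. *)
pose Y := P *m map_mx i X *m invmx P.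
have YE t : fixing (Qp v) t -> Y *m ind t =
    i (cyclotomic_char kappa l (restrict_aut iota t)) *: (ind t *m Y).
  move=> tG; have /= tE := PE t tG; have /= := invX t tG.
  set r := rhobar _ in tE *; set c := cyclotomic_char _ _ _ => XE.
  have {}XE : X *m r = c *: (r *m X).
    by rewrite -{1}XE -scalemxAl mulmxKV // rho_unit.
  have indE : ind t = P *m map_mx i r *m invmx P by rewrite tE mulmxK.
  have XEi : map_mx i X *m map_mx i r = i c *: (map_mx i r *m map_mx i X).
    by rewrite -!map_mxM XE map_mxZ.
  rewrite /Y indE !mulmxA !mulmxKV // -(mulmxA P) XEi.
  by rewrite -scalemxAr -scalemxAl mulmxA.
have Y0 : Y = 0.
  apply: (@twisted_ad0_eq0 k 3%:R _ (ind g) (ind s)); last exact: YE.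
  - by rewrite mxtrace_mulC mulKmx // trace_map_mx trX rmorph0.
  - by rewrite -subr_eq0 -(natrB _ (isT : 1 <= 3)%N) natk // (leq_trans _ l_ge5).
  - by rewrite -natrX -subr_eq0 -(natrB _ (isT : 1 <= 9)%N).
  - exact: ind_unit.
  (* The off-diagonal entries of [ind g] sit at [g * s] and [s^-1 * g], and both diagonal entries of
     [ind s] at [s]; all of these negate [d]. *)
  - by rewrite mxE /= notK // invg1 mul1g; rewrite -[LHS]/(g (s d)) s_d rmorphN /= gd.
  - by rewrite mxE /= notK // mulg1; rewrite -[LHS]/((s^-1)%g (g d)) gd.
  - exact: ind_unit.
  - by rewrite mxE /= notK // invg1 mul1g mulg1.
  - by rewrite mxE /= notK // mulVg mul1g.
  - by rewrite -(rmorph_nat i) -eps_g; exact: YE.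
apply: (@map_mx_inj _ _ i); rewrite map_mx0.
have -> : map_mx i X = invmx P *m Y *m P by rewrite /Y !mulmxA mulVmx // mul1mx mulmxKV.
by rewrite Y0 mulmx0 mul0mx.
Qed.
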